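(* For every integer $n\ge 1$, the fan graph $F_{1,n}$ satisfies $$\alpha(F_{1,n})+\alpha(L(F_{1,n}))=\begin{cases} n & \text{if } n \text{ is even},\\ n+1 & \text{if } n \text{ is odd},\end{cases}$$ and $$\alpha(F_{1,n})\cdot\alpha(L(F_{1,n}))=\begin{cases} \dfrac{n^2}{4} & \text{if } n \text{ is even},\\[2mm] \dfrac{(n+1)^2}{4} & \text{if } n \text{ is odd}.\end{cases}$$
   Context: The fan graph $F_{1,n}$ is the graph $K_1+P_n$, the join of a single vertex with the path $P_n=v_1,v_2,\ldots,v_n$ on $n$ vertices. For a graph $G$, $\alpha(G)$ denotes its independence number, i.e. the maximum cardinality of a set of pairwise non-adjacent vertices of $G$. $L(G)$ denotes the line graph of $G$: its vertices are in one-to-one correspondence with the edges of $G$, and two vertices of $L(G)$ are adjacent if and only if the corresponding edges of $G$ are adjacent (share an endpoint). *)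

(* Defs.v *)
From mathcomp Require Import all_boot all_order all_algebra.

Set Implicit Arguments.
Unset Strict Implicit.
Unset Printing Implicit Defensive.

Record sgraph := SGraph {
  vertex :> finType;
  adj : rel vertex;
  adj_sym : symmetric adj;
  adj_irr : irreflexive adj }.

Section Independence.
Variable G : sgraph.

Definition independent (S : {set G}) : bool :=
  [forall x in S, forall y in S, ~~ adj x y].

Definition alpha : nat := \max_(S : {set G} | independent S) #|S|.

End Independence.

Section LineGraph.
Variable G : sgraph.

(* An edge {x, y} is encoded as the vertex set [set x; y]. *)
Definition edges : {set {set G}} :=
  [set e | [exists x, exists y, adj x y && (e == [set x; y])]].

Definition line_vertex : finType := {e : {set G} | e \in edges}.

Definition line_adj (e f : line_vertex) : bool :=
  (e != f) && [exists x, (x \in val e) && (x \in val f)].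

Lemma line_adj_sym : symmetric line_adj.
Proof.
move=> e f; rewrite /line_adj eq_sym; congr (_ && _).
by apply: eq_existsb => x; rewrite andbC.
Qed.

Lemma line_adj_irr : irreflexive line_adj.
Proof. by move=> e; rewrite /line_adj eqxx. Qed.

Definition line_graph : sgraph := SGraph line_adj_sym line_adj_irr.

End LineGraph.

Section Join.
Variables G H : sgraph.

Definition join_adj (u v : G + H) : bool :=
  match u, v with
  | inl x, inl y => adj x y
  | inr x, inr y => adj x y
  | _, _ => true
  end.

Lemma join_adj_sym : symmetric join_adj.
Proof. by move=> [x|x] [y|y] //=; apply: adj_sym. Qed.

Lemma join_adj_irr : irreflexive join_adj.
Proof. by move=> [x|x] /=; apply: adj_irr. Qed.

Definition join_graph : sgraph := SGraph join_adj_sym join_adj_irr.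

End Join.

Section CompletePath.
Variable n : nat.

Definition complete_adj (i j : 'I_n) : bool := i != j.

Lemma complete_adj_sym : symmetric complete_adj.
Proof. by move=> i j; rewrite /complete_adj eq_sym. Qed.

Lemma complete_adj_irr : irreflexive complete_adj.
Proof. by move=> i; rewrite /complete_adj eqxx. Qed.

Definition complete_graph : sgraph := SGraph complete_adj_sym complete_adj_irr.

Definition path_adj (i j : 'I_n) : bool := (i.+1 == j) || (j.+1 == i).

Lemma path_adj_sym : symmetric path_adj.
Proof. by move=> i j; rewrite /path_adj orbC. Qed.

Lemma path_adj_irr : irreflexive path_adj.
Proof. by move=> i; rewrite /path_adj orbb -[X in _ == X]add0n -add1n eqn_add2r. Qed.

Definition path_graph : sgraph := SGraph path_adj_sym path_adj_irr.

End CompletePath.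

Definition fan_graph (n : nat) : sgraph :=
  join_graph (complete_graph 1) (path_graph n).

(* Main.v *)
Require Import Defs.
From mathcomp Require Import all_boot all_order all_algebra.
From mathcomp Require Import zify ring.

(** Both independence numbers equal [uphalf n]. Pairing consecutive path vertices,
    with the hub added to the first pair, covers the fan by [uphalf n] cliques, and the path
    vertices of even index are independent. An independent set of the line graph
    is a matching of the [n + 1] vertices, so it has at most [n.+1./2] edges, and
    every other edge of the Hamiltonian path hub, v_1, ..., v_n reaches this bound. *)

(** The fibres of [f] are cliques, so [f] is injective on any independent set. *)
Lemma alpha_le_clique_cover (G : sgraph) (k : nat) (f : G -> 'I_k) :
  (forall x y, f x = f y -> x != y -> adj x y) -> alpha G <= k.
Proof.
move=> clique_f; apply/bigmax_leqP => S /'forall_in_forall_inP indS.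
rewrite -[k in _ <= k]card_ord -(@card_in_imset _ _ f) ?max_card // => x y xS yS fxy.
apply/eqP; apply: contraNT (indS x xS y yS); exact: clique_f.
Qed.

Lemma alpha_ge_family (G : sgraph) (k : nat) (g : 'I_k -> G) :
  injective g -> (forall i j, ~~ adj (g i) (g j)) -> k <= alpha G.
Proof.
move=> g_inj indg.
rewrite /alpha -[k in k <= _]card_ord -cardsT -(card_imset [set: 'I_k] g_inj).
apply: (@leq_bigmax_cond _ _ (fun S : {set G} => #|S|)).
apply/'forall_in_forall_inP => _ /imsetP[i _ ->] _ /imsetP[j _ ->]; exact: indg.
Qed.

Lemma card_edge (G : sgraph) (e : {set G}) : e \in edges G -> #|e| = 2.
Proof.
rewrite inE => /existsP[x /existsP[y /andP[xy /eqP ->]]].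
rewrite cards2; case: eqVneq xy => // ->; by rewrite adj_irr.
Qed.

(** Pairwise non-adjacent edges are disjoint pairs, so their union has twice as many vertices as
    there are edges. *)
Lemma alpha_line_graph_le (G : sgraph) : alpha (line_graph G) <= #|G|./2.
Proof.
apply/bigmax_leqP => M /'forall_in_forall_inP indM.
rewrite geq_half_double -muln2.
have -> : #|M| = #|val @: M| by rewrite card_imset //; exact: val_inj.
have trivM : trivIset (val @: M).
  apply/trivIsetP => _ _ /imsetP[e eM ->] /imsetP[f fM ->] ef.
  apply/pred0P => x /=; apply/negP => xef.
  have /negP := indM e eM f fM; apply; apply/andP; split.
    by apply: contraNneq ef => ->.
  by apply/existsP; exists x.
apply: leq_trans (max_card (cover (val @: M))).
move: trivM; rewrite /trivIset => /eqP <-.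
rewrite -sum_nat_const; apply: leq_sum => _ /imsetP[e _ ->].
by rewrite card_edge // (valP e).
Qed.

(** Along the path [h 0, ..., h m.-1], the edges joining [h j.*2] to [h j.*2.+1] form a matching. *)
Lemma alpha_line_graph_ge_path (G : sgraph) (m : nat) (h : nat -> G) :
  {in gtn m &, injective h} -> (forall i, i.+1 < m -> adj (h i) (h i.+1)) ->
  m./2 <= alpha (line_graph G).
Proof.
move=> h_inj h_adj.
have bound (j : 'I_m./2) : j.*2.+1 < m by have := ltn_ord j; lia.
have in_edges (j : 'I_m./2) : [set h j.*2; h j.*2.+1] \in edges G.
  rewrite inE; apply/existsP; exists (h j.*2).
  apply/existsP; exists (h j.*2.+1); by rewrite h_adj ?bound /=.
pose e j : line_graph G := exist (fun f => f \in edges G) _ (in_edges j).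
have share i j x : x \in val (e i) -> x \in val (e j) -> i = j.
  have bi := bound i; have bj := bound j.
  (* Positions on the path agree by injectivity: equal parities force [i = j], and mixed parities
     are impossible. *)
  rewrite !inE => /orP[] /eqP -> /orP[] /eqP /h_inj; rewrite !inE => H;
    apply: val_inj => /=; have := H ltac:(lia) ltac:(lia); lia.
apply: (@alpha_ge_family _ _ e) => [i j eij | i j].
  by apply: (share i j (h i.*2)); rewrite -?eij !inE eqxx.
apply/negP => /andP[neq /existsP[x /andP[xi xj]]].
by rewrite (share i j x xi xj) eqxx in neq.
Qed.

Lemma alpha_fan (n : nat) : 0 < n -> alpha (fan_graph n) = uphalf n.
Proof.
case: n => // n _; apply/eqP; rewrite eqn_leq; apply/andP; split.
  (* Path indices start at 0, so class [k] holds the indices [k.*2] and [k.*2.+1]; the hub may join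
     class 0 since it is adjacent to every path vertex. *)
  pose f (x : fan_graph n.+1) : 'I_(uphalf n.+1) :=
    if x is inr i then inord i./2 else ord0.
  apply: (@alpha_le_clique_cover _ _ f) => -[x|x] [y|y] //=.
  move=> /(congr1 val); rewrite /= !inordK; last 2 first.
  - by have := ltn_ord y; lia.
  - by have := ltn_ord x; lia.
  move=> half_eq xy; have {xy} : (x : nat) != y by apply: contraNneq xy => /val_inj ->.
  rewrite /path_adj; lia.
have bound (j : 'I_(uphalf n.+1)) : j.*2 < n.+1 by have := ltn_ord j; lia.
apply: (@alpha_ge_family _ _ (fun j => inr (Ordinal (bound j)) : fan_graph n.+1)).
  by move=> i j [] ij; apply: val_inj => /=; lia.
by move=> i j /=; rewrite /path_adj /=; lia.
Qed.

Lemma alpha_line_fan (n : nat) :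
  0 < n -> alpha (line_graph (fan_graph n)) = uphalf n.
Proof.
case: n => // n _; apply/eqP; rewrite eqn_leq; apply/andP; split.
  apply: leq_trans (alpha_line_graph_le _) _.
  by rewrite /= card_sum !card_ord.
(* The Hamiltonian path from the hub; for positions below [n.+2] the argument of [inord] is in
   range. *)
pose h i : fan_graph n.+1 := if i is i'.+1 then inr (inord i') else inl ord0.
apply: (@alpha_line_graph_ge_path _ n.+2 h) => [[|i] [|j] | [|i] lt_in] //.
  rewrite !inE !ltnS => lt_in lt_jn [] /(congr1 val).
  by rewrite /= !inordK // => ->.
by rewrite /= /path_adj !inordK ?eqxx // -ltnS ltnW.
Qed.

Theorem theorem2p10 (n : nat) (hn : (1 <= n)%N) :
  (alpha (fan_graph n) + alpha (line_graph (fan_graph n)))%N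
    = (if ~~ odd n then n else n + 1)%N
  /\
  ((alpha (fan_graph n) * alpha (line_graph (fan_graph n)))%N%:R
    = (if ~~ odd n then n%:R ^+ 2 / 4 else (n%:R + 1) ^+ 2 / 4) :> rat)%R.
Proof.
rewrite alpha_fan // alpha_line_fan //.
have sum_eq : uphalf n + uphalf n = if ~~ odd n then n else n + 1.
  by case: ifP; lia.
split=> //.
(* Since the two factors are equal, their product is a quarter of the square of their sum, whatever
   the parity. *)
have -> : (if ~~ odd n then n%:R ^+ 2 / 4 else (n%:R + 1) ^+ 2 / 4 : rat)%R
  = ((uphalf n + uphalf n)%:R ^+ 2 / 4)%R.
  by rewrite sum_eq; case: ifP; rewrite // GRing.natrD.
by rewrite GRing.natrM GRing.natrD; field.
Qed.
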